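(* Let $E, F$ be Riesz spaces and $S,T \in \mathcal{O}(E,F)$. If for every $x \in E$ the infimum $R(x) := \inf \{S(u) + T(v): \, x = u \sqcup v\}$ exists in $F$, then $S \wedge T$ exists in $\mathcal{O}(E,F)$ and $S \wedge T = R$. Moreover, in the case of existence (of the infima $R(x)$ for all $x\in E$) the following hold. (1) If $S,T \in \mathcal{P}(E,F)$ then $S \wedge T \in \mathcal{P}(E,F)$. (2) If $S,T \in \mathcal{U}(E,F)$ then $S \wedge T \in \mathcal{U}(E,F)$.
   Context: A Riesz space is a real vector lattice (no Dedekind completeness or Archimedean property is assumed); $x \perp y$ (disjointness) means $|x| \wedge |y| = 0$. The notation $x = u \sqcup v$ means $x = u + v$ and $u \perp v$; the infimum is over all such pairs $u,v\in E$. An element $x$ is a fragment of $y$, written $x \sqsubseteq y$, if $x \perp y - x$; $\mathfrak{F}_e$ is the set of all fragments of $e$. A function $T \colon E \to F$ is an orthogonally additive operator (OAO) if $T(x+y) = T(x) + T(y)$ for all disjoint $x,y \in E$. $\mathcal{O}(E,F)$ is the vector space of all OAOs, ordered by $S \le T$ iff $S(x) \le T(x)$ for all $x \in E$; $S \wedge T$ denotes the greatest lower bound of $S,T$ in this ordered vector space. $\mathcal{P}(E,F)$ is the set of laterally-to-order bounded OAOs, i.e. those $T$ for which $T(\mathfrak{F}_e)$ is order bounded in $F$ for every $e \in E$. $\mathcal{U}(E,F)$ is the set of order bounded OAOs (abstract Uryson operators), i.e. those sending order bounded subsets of $E$ to order bounded subsets of $F$. *)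

(* Defs.v *)
From HB Require Import structures.
From mathcomp Require Import all_boot all_order all_algebra.
From mathcomp Require Import all_classical reals.

Set Implicit Arguments.
Unset Strict Implicit.
Unset Printing Implicit Defensive.

Import Order.TTheory GRing.Theory Num.Theory.
Local Open Scope classical_set_scope.
Local Open Scope ring_scope.

(* [Order.Lattice] cannot be a parent of this structure: it would create a
   second join of the additive and the lattice hierarchies, next to the one
   through [realDomainType].  So the mixin carries the lattice operations, and
   every [rieszType] is made a [latticeType] just below. *)
HB.mixin Record isRiesz (R : realType) E
    of GRing.Lmodule R E & Order.POrder ring_display E := {
  riesz_meet : E -> E -> E ;
  riesz_join : E -> E -> E ;
  riesz_lexI : forall x y z : E,
    (x <= riesz_meet y z) = (x <= y) && (x <= z) ;
  riesz_leUx : forall x y z : E,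
    (riesz_join x y <= z) = (x <= z) && (y <= z) ;
  riesz_leD2r : forall x y z : E, x <= y -> x + z <= y + z ;
  riesz_scale_ge0 : forall (a : R) (x : E), 0 <= a -> 0 <= x -> 0 <= a *: x
}.

#[short(type="rieszType")]
HB.structure Definition Riesz (R : realType) :=
  { E of GRing.Lmodule R E & Order.POrder ring_display E & isRiesz R E }.

HB.instance Definition _ (R : realType) (E : rieszType R) :=
  Order.POrder_MeetJoin_isLattice.Build ring_display (Riesz.sort E)
    (@riesz_lexI R E) (@riesz_leUx R E).

Section RieszDefs.
Context {R : realType} {E : rieszType R}.

Definition riesz_abs (x : E) : E := (x `|` - x)%O.

Definition disj (x y : E) : Prop := (riesz_abs x `&` riesz_abs y)%O = 0.

(* x = u \sqcup v *)
Definition disj_sum (x u v : E) : Prop := x = u + v /\ disj u v.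

Definition fragment (x y : E) : Prop := disj x (y - x).

Definition fragments (e : E) : set E := [set x | fragment x e].

Definition order_bounded (A : set E) : Prop := has_lbound A /\ has_ubound A.

End RieszDefs.

Section OAO.
Context {R : realType} (E F : rieszType R).

Definition orthogonally_additive (f : E -> F) : Prop :=
  forall x y, disj x y -> f (x + y) = f x + f y.

Definition oao_pred : {pred E -> F} :=
  fun f => `[< orthogonally_additive f >].

Record oao := Oao { oao_fun :> E -> F ; _ : oao_fun \in oao_pred }.

HB.instance Definition _ := [isSub for oao_fun].
HB.instance Definition _ := [Choice of oao by <:].

Lemma oao_submod_closed : submod_closed oao_pred.
Proof.
split=> [|a f g /asboolP fA /asboolP gA]; apply/asboolP=> x y xy.
  by rewrite addr0.
rewrite !fctE fA// gA// scalerDr.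
exact: addrACA.
Qed.

HB.instance Definition _ :=
  GRing.isSubmodClosed.Build R (E -> F) oao_pred oao_submod_closed.
HB.instance Definition _ := [SubChoice_isSubLmodule of oao by <:].

(* The order inherited from E -> F is the pointwise one, see [oao_leP]. *)
HB.instance Definition _ := [SubChoice_isSubPOrder of oao by <: with ring_display].

Lemma oao_leP (S T : oao) : S <= T <-> forall x, S x <= T x.
Proof. by split=> [/asboolP|h]; last exact/asboolP. Qed.

Definition laterally_to_order_bounded : set oao :=
  [set T | forall e : E, order_bounded (T @` fragments e)].

Definition uryson : set oao :=
  [set T | forall A : set E, order_bounded A -> order_bounded (T @` A)].

End OAO.

Definition split_sums (R : realType) (E F : rieszType R) (S T : E -> F)
    (x : E) : set F :=
  [set w | exists u v, disj_sum x u v /\ w = S u + T v].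

(* Main.v *)
(** The infimum over the splittings of [x] is additive on a disjoint sum
    [x + y], because splittings of [x + y] are exactly the sums of a splitting
    of [x] and one of [y].  This rests on the refinement property of Riesz
    spaces: if [x + y = w + z] with [x], [y] disjoint and [w], [z] disjoint,
    then all four elements are sums of entries of a 2 x 2 array of pairwise
    disjoint elements.  For nonnegative elements the entries are the meets;
    in general they are the differences of the entries obtained for the
    positive and for the negative parts.  Boundedness of the infimum follows
    since both members of a splitting of [x] are fragments of [x], and are
    dominated by [|x|]. *)
Require Import Defs.
From mathcomp Require Import all_boot all_order all_algebra.
From mathcomp Require Import all_classical reals.
Import Order.TTheory GRing.Theory Num.Theory.
Local Open Scope classical_set_scope.
Local Open Scope ring_scope.

(** * Order arithmetic and absolute values in a Riesz space *)

Section RieszTheory.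
Context {R : realType} {E : rieszType R}.
Implicit Types a b c u v w x y z : E.

Lemma riesz_leD2rE z x y : (x + z <= y + z) = (x <= y).
Proof.
apply/idP/idP; last exact: riesz_leD2r.
by move=> /(riesz_leD2r _ _ (- z)); rewrite !addrK.
Qed.

Lemma riesz_leBlDr x y z : (x - y <= z) = (x <= z + y).
Proof. by rewrite -(riesz_leD2rE y (x - y)) subrK. Qed.

Lemma riesz_leBlDl x y z : (x - y <= z) = (x <= y + z).
Proof. by rewrite riesz_leBlDr addrC. Qed.

Lemma riesz_leBrDr x y z : (x <= y - z) = (x + z <= y).
Proof. by rewrite -(riesz_leD2rE z x) subrK. Qed.

Lemma riesz_leD a b x y : a <= x -> b <= y -> a + b <= x + y.
Proof.
move=> ax /(riesz_leD2r _ _ x); rewrite ![_ + x]addrC; apply: le_trans.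
by rewrite riesz_leD2rE.
Qed.

Lemma riesz_leN2 x y : (- x <= - y) = (y <= x).
Proof. by rewrite -(riesz_leD2rE (x + y) (- x)) addKr [x + y]addrC addKr. Qed.

Lemma riesz_leDl x y : 0 <= y -> x <= x + y.
Proof. by move=> y0; rewrite -{1}[x]addr0; exact: riesz_leD. Qed.

Lemma riesz_leBl x y : 0 <= y -> x - y <= x.
Proof. by move=> y0; rewrite riesz_leBlDr riesz_leDl. Qed.

Lemma riesz_le_abs x : x <= riesz_abs x.
Proof. exact: leUl. Qed.

Lemma riesz_leN_abs x : - x <= riesz_abs x.
Proof. exact: leUr. Qed.

Lemma riesz_abs_le x y : (riesz_abs x <= y) = (x <= y) && (- x <= y).
Proof. exact: leUx. Qed.

Lemma riesz_abs_ge0 x : 0 <= riesz_abs x.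
Proof.
(* Adding [x <= |x|] and [- x <= |x|] gives [0 <= 2 |x|]; scaling by one half concludes. *)
have abs2 : 0 <= 2%:R *: riesz_abs x.
  rewrite scaler_nat mulr2n -(subrr x).
  by apply: riesz_leD; [exact: riesz_le_abs|exact: riesz_leN_abs].
have /(@riesz_scale_ge0 R E 2^-1) := abs2.
by rewrite scalerA mulVf ?pnatr_eq0// scale1r invr_ge0 ler0n; apply.
Qed.

Lemma riesz_abs0 : riesz_abs (0 : E) = 0.
Proof. by rewrite /riesz_abs oppr0 joinxx. Qed.

Lemma riesz_absN x : riesz_abs (- x) = riesz_abs x.
Proof. by rewrite /riesz_abs opprK joinC. Qed.

Lemma riesz_absD x y : riesz_abs (x + y) <= riesz_abs x + riesz_abs y.
Proof.
by rewrite riesz_abs_le opprD !riesz_leD ?riesz_le_abs ?riesz_leN_abs.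
Qed.

Lemma riesz_abs_itv a b x : a <= x -> x <= b ->
  riesz_abs x <= riesz_abs a + riesz_abs b.
Proof.
move=> ax xb; rewrite riesz_abs_le; apply/andP; split.
  rewrite addrC (le_trans xb)// (le_trans (riesz_le_abs b))//.
  exact/riesz_leDl/riesz_abs_ge0.
rewrite (@le_trans _ _ (- a)) ?riesz_leN2// (le_trans (riesz_leN_abs a))//.
exact/riesz_leDl/riesz_abs_ge0.
Qed.

(** Moving each summand of the right side across in turn reduces the claim to [m <= a + b], [m <= c]
    and positivity. This makes disjointness stable under sums. *)
Lemma riesz_meetDl_le a b c : 0 <= a -> 0 <= b -> 0 <= c ->
  ((a + b) `&` c <= (a `&` c) + (b `&` c))%O.
Proof.
move=> a0 b0 c0; set m := ((a + b) `&` c)%O.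
have mc : m <= c by exact: leIr.
rewrite -riesz_leBlDr lexI; apply/andP; split; last first.
  by rewrite (le_trans _ mc)// riesz_leBl// lexI b0.
rewrite riesz_leBlDr -riesz_leBlDl lexI riesz_leBlDl leIl/=.
by rewrite (le_trans _ mc)// riesz_leBl.
Qed.

(** [a + b - x] lies below both [a] and [b], hence below their meet. *)
Lemma riesz_leD_disj a b x : (a `&` b)%O = 0 -> a <= x -> b <= x -> a + b <= x.
Proof.
move=> ab0 ax bx; rewrite -[leRHS]add0r -riesz_leBlDr -ab0 lexI.
rewrite riesz_leBlDr riesz_leBlDl !riesz_leD//.
Qed.

(** * Disjointness *)

Lemma disj_sym x y : disj x y -> disj y x.
Proof. by rewrite /disj meetC. Qed.

Lemma disj0 x : disj x 0.
Proof. by rewrite /disj riesz_abs0; apply/meet_idPr/riesz_abs_ge0. Qed.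

Lemma disj_le u v x y : riesz_abs u <= riesz_abs x -> riesz_abs v <= riesz_abs y ->
  disj x y -> disj u v.
Proof.
move=> ux vy xy; apply/le_anti/andP; split; last by rewrite lexI !riesz_abs_ge0.
by rewrite -xy leI2.
Qed.

Lemma disjDl x y z : disj x z -> disj y z -> disj (x + y) z.
Proof.
move=> xz yz; apply/le_anti/andP; split; last by rewrite lexI !riesz_abs_ge0.
apply: (@le_trans _ _ ((riesz_abs x + riesz_abs y) `&` riesz_abs z)%O).
  by rewrite leI2 ?riesz_absD.
by rewrite (le_trans (riesz_meetDl_le _ _ _ _ _ _)) ?riesz_abs_ge0// xz yz addr0.
Qed.

Lemma disjDr x y z : disj z x -> disj z y -> disj z (x + y).
Proof. by move=> /disj_sym zx /disj_sym zy; apply/disj_sym/disjDl. Qed.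

Lemma disj_ge0 x y : 0 <= x -> 0 <= y -> disj x y <-> (x `&` y)%O = 0.
Proof.
have abs z : 0 <= z -> riesz_abs z = z.
  by move=> z0; apply/join_idPl/(le_trans _ z0); rewrite -oppr0 riesz_leN2.
by move=> x0 y0; rewrite /disj !abs.
Qed.

(** Since [u = (u + v) - v], [|u|] is at most [|u + v| + |v|]; on taking the meet with [|u|], the
    term in [|v|] vanishes. *)
Lemma disj_le_absD u v : disj u v -> riesz_abs u <= riesz_abs (u + v).
Proof.
move=> uv; have : riesz_abs u <=
    ((riesz_abs (u + v) + riesz_abs v) `&` riesz_abs u)%O.
  rewrite lexI lexx andbT -{1}(addrK v u) (le_trans (riesz_absD _ _))//.
  by rewrite riesz_absN.
move/le_trans; apply; rewrite (le_trans (riesz_meetDl_le _ _ _ _ _ _)) ?riesz_abs_ge0//.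
by rewrite (disj_sym _ _ uv) addr0 leIl.
Qed.

(** * Positive parts and the refinement property *)

Definition riesz_pos x : E := (x `|` 0)%O.

Lemma riesz_pos_ge0 x : 0 <= riesz_pos x.
Proof. exact: leUr. Qed.

Lemma riesz_pos_le_abs x : riesz_pos x <= riesz_abs x.
Proof. by rewrite leUx riesz_le_abs riesz_abs_ge0. Qed.

(** Uniqueness of the Jordan decomposition: for [j] the positive part, [a - j] lies below both [a]
    and [b], hence below zero. *)
Lemma riesz_posB a b : 0 <= a -> 0 <= b -> (a `&` b)%O = 0 ->
  riesz_pos (a - b) = a.
Proof.
move=> a0 b0 ab0; apply/le_anti/andP; split; first by rewrite leUx riesz_leBl.
have j0 := riesz_pos_ge0 (a - b); have : a - b <= riesz_pos (a - b) by exact: leUl.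
set j := riesz_pos _ in j0 *.
move=> abj; rewrite -[leRHS]add0r -riesz_leBlDr -ab0 lexI riesz_leBl//=.
by rewrite riesz_leBlDl -riesz_leBlDr.
Qed.

Lemma riesz_posE x : x = riesz_pos x - riesz_pos (- x).
Proof.
suff : riesz_pos x = x + riesz_pos (- x) by move->; rewrite addrK.
apply/le_anti/andP; split.
  rewrite leUx riesz_leDl ?riesz_pos_ge0//=.
  by rewrite addrC -riesz_leBlDr add0r leUl.
by rewrite addrC -riesz_leBrDr leUx !riesz_leBrDr addNr add0r leUr leUl.
Qed.

(** With the meet [m] subtracted, the positive part still dominates [x] and [0], so minimality
    forces [m <= 0]. *)
Lemma riesz_posNI x : (riesz_pos x `&` riesz_pos (- x))%O = 0.
Proof.
apply/le_anti/andP; split; last by rewrite lexI !riesz_pos_ge0.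
set m := (_ `&` _)%O.
have : riesz_pos x <= riesz_pos x - m.
  rewrite leUx {1}[x]riesz_posE riesz_leD ?riesz_leN2 ?leIr//=.
  by rewrite riesz_leBrDr add0r leIl.
by rewrite riesz_leBrDr addrC -riesz_leBrDr subrr.
Qed.

Lemma riesz_abs_pos x : riesz_abs (riesz_pos x) <= riesz_abs x.
Proof.
rewrite riesz_abs_le riesz_pos_le_abs (le_trans _ (riesz_abs_ge0 _))//.
by rewrite -oppr0 riesz_leN2 riesz_pos_ge0.
Qed.

Lemma disj_pos x y : disj x y -> disj (riesz_pos x) (riesz_pos y).
Proof. by apply: disj_le; exact: riesz_abs_pos. Qed.

Lemma riesz_posD x y : disj x y -> riesz_pos (x + y) = riesz_pos x + riesz_pos y.
Proof.
move=> xy; rewrite {1}[x]riesz_posE {1}[y]riesz_posE addrACA -opprD.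
have pos_ge0 u v : 0 <= riesz_pos u + riesz_pos v.
  by rewrite -[leLHS]addr0 riesz_leD ?riesz_pos_ge0.
have disjN u v : disj u v -> disj u (- v) by rewrite /disj riesz_absN.
have posNI u : disj (riesz_pos u) (riesz_pos (- u)).
  by apply/disj_ge0; rewrite ?riesz_pos_ge0 ?riesz_posNI.
apply: riesz_posB => //; apply/disj_ge0 => //.
by apply: disjDl; apply: disjDr => //; apply/disj_pos/disjN => //; exact: disj_sym.
Qed.

(** One inequality is subadditivity of the meet; the other holds because the two meets are disjoint
    and both lie below [x]. *)
Lemma riesz_meet_split x w z : 0 <= x -> 0 <= w -> 0 <= z ->
  (w `&` z)%O = 0 -> x <= w + z -> x = ((x `&` w) + (x `&` z))%O.
Proof.
move=> x0 w0 z0 wz xwz; apply/le_anti/andP; split.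
  rewrite ![(x `&` _)%O]meetC.
  by rewrite (le_trans _ (riesz_meetDl_le _ _ _ _ _ _))// lexI xwz lexx.
apply: riesz_leD_disj; rewrite ?leIl//.
by rewrite meetACA wz meetxx; apply/meet_idPr.
Qed.

Lemma disj_refinement x y w z : disj x y -> disj w z -> x + y = w + z ->
  exists x1 x2 y1 y2, [/\ disj_sum x x1 x2, disj_sum y y1 y2,
    disj_sum w x1 y1 & disj_sum z x2 y2].
Proof.
pose p (u v : E) := (riesz_pos u `&` riesz_pos v)%O.
pose q u v := p u v - p (- u) (- v).
have p_ge0 u v : 0 <= p u v by rewrite lexI !riesz_pos_ge0.
have pC u v : p u v = p v u by exact: meetC.
have qC u v : q u v = q v u by rewrite /q pC [p (- u) _]pC.
(* Domination by both arguments lets the entries of the array inherit disjointness from the given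
   pairs. *)
have q_le u v : riesz_abs (q u v) <= riesz_abs u.
  rewrite riesz_abs_le opprB; apply/andP; split.
    rewrite (le_trans (riesz_leBl _ _ _))// (le_trans _ (riesz_pos_le_abs _))//.
    exact: leIl.
  rewrite (le_trans (riesz_leBl _ _ _))// -riesz_absN.
  by rewrite (le_trans _ (riesz_pos_le_abs _))// leIl.
have q_le' u v : riesz_abs (q u v) <= riesz_abs v by rewrite qC.
have disjN u v : disj u v -> disj (- u) (- v) by rewrite /disj !riesz_absN.
have pE u1 u2 v1 v2 : disj u1 u2 -> disj v1 v2 -> u1 + u2 = v1 + v2 ->
    riesz_pos u1 = p u1 v1 + p u1 v2.
  move=> u12 v12 uv; apply: riesz_meet_split; rewrite ?riesz_pos_ge0//.
    apply/disj_ge0; rewrite ?riesz_pos_ge0//; exact: disj_pos.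
  by rewrite -riesz_posD// -uv riesz_posD// riesz_leDl// riesz_pos_ge0.
(* The hypotheses survive negation, so [pE] also splits the negative parts. *)
have qE u1 u2 v1 v2 : disj u1 u2 -> disj v1 v2 -> u1 + u2 = v1 + v2 ->
    u1 = q u1 v1 + q u1 v2.
  move=> u12 v12 uv; rewrite {1}[u1]riesz_posE (pE u1 u2 v1 v2)//.
  rewrite (pE (- u1) (- u2) (- v1) (- v2)); first by rewrite opprD addrACA.
  - exact: disjN.
  - exact: disjN.
  - by rewrite -!opprD uv.
move=> xy wz e.
exists (q x w), (q x z), (q y w), (q y z).
have [yx zw] := (disj_sym _ _ xy, disj_sym _ _ wz).
split; split.
- exact: qE xy wz e.
- exact: disj_le wz.
- by apply: qE yx wz _; rewrite addrC.
- exact: disj_le wz.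
(* Column sums are row sums of the transposed array. *)
- by rewrite ![q _ w]qC; apply: qE wz xy _.
- exact: disj_le xy.
- by rewrite ![q _ z]qC; apply: qE zw xy _; rewrite addrC.
- exact: disj_le xy.
Qed.

Lemma disj_sum_disj x y x1 x2 y1 y2 : disj x y -> disj_sum x x1 x2 ->
  disj_sum y y1 y2 -> disj_sum (x + y) (x1 + y1) (x2 + y2).
Proof.
move=> xy [xE x12] [yE y12]; split; first by rewrite xE yE addrACA.
have x1x : riesz_abs x1 <= riesz_abs x by rewrite xE disj_le_absD.
have x2x : riesz_abs x2 <= riesz_abs x.
  by rewrite xE addrC disj_le_absD//; exact: disj_sym.
have y1y : riesz_abs y1 <= riesz_abs y by rewrite yE disj_le_absD.
have y2y : riesz_abs y2 <= riesz_abs y.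
  by rewrite yE addrC disj_le_absD//; exact: disj_sym.
apply: disjDl; apply: disjDr => //; first exact: disj_le xy.
exact: disj_le (disj_sym _ _ xy).
Qed.

Lemma disj_sum_sym x u v : disj_sum x u v -> disj_sum x v u.
Proof. by move=> [-> uv]; split; [rewrite addrC|exact: disj_sym]. Qed.

Lemma disj_sum_le_abs x u v : disj_sum x u v -> riesz_abs u <= riesz_abs x.
Proof. by move=> [-> uv]; exact: disj_le_absD. Qed.

(** In [e - u = v + (e - x)], [u] is disjoint from [v] by the splitting and from [e - x] because
    [|u| <= |x|]. *)
Lemma disj_sum_fragment e x u v : fragment x e -> disj_sum x u v -> fragment u e.
Proof.
move=> xe xuv; have ux := disj_sum_le_abs _ _ _ xuv.
case: xuv => xE uv; rewrite /fragment.
have -> : e - u = v + (e - x) by rewrite xE addrCA [u + v]addrC opprD addNKr.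
by apply: disjDr => //; exact: disj_le xe.
Qed.
End RieszTheory.

(** The two hypotheses exclude the cases where [infimum] falls back to the default [x0]. *)
Lemma infimumP {d} {T : porderType d} (x0 : T) {A : set T} :
  A !=set0 -> infimums A !=set0 -> infimums A (infimum x0 A).
Proof.
move=> /set0P/negPf A0 [i Ai]; rewrite /infimum A0; exact: xgetI Ai.
Qed.

(** * Infima over splittings *)

Section InfimumOfSplittings.
Context {R : realType} {E F : rieszType R}.
Implicit Types (S T L : oao E F) (x y e : E).

Lemma oaoD S x y : disj x y -> S (x + y) = S x + S y.
Proof. by case: S => f /= /asboolP; apply. Qed.

Lemma oao0 S : S 0 = 0.
Proof.
have := oaoD S 0 0 (disj0 0); rewrite addr0 => /eqP.
by rewrite -subr_eq subrr => /eqP.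
Qed.

Lemma split_sums_l S T x : split_sums S T x (S x).
Proof.
by exists x, 0; rewrite oao0 addr0; split=> //; split; [rewrite addr0|exact: disj0].
Qed.

Lemma split_sums_r S T x : split_sums S T x (T x).
Proof.
exists 0, x; rewrite oao0 add0r; split=> //; split; first by rewrite add0r.
exact/disj_sym/disj0.
Qed.

Lemma split_sums_lbound S T L x : L <= S -> L <= T ->
  lbound (split_sums S T x) (L x).
Proof.
move=> /oao_leP LS /oao_leP LT _ [u [v [[-> uv] ->]]].
by rewrite oaoD// riesz_leD.
Qed.

Lemma infimums_split_sumsD S T x y a b c : disj x y ->
  infimums (split_sums S T x) a -> infimums (split_sums S T y) b ->
  infimums (split_sums S T (x + y)) c -> c = a + b.
Proof.
move=> xy [al ag] [bl bg] [cl cg]; apply/le_anti/andP; split.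
  (* The two infima are handled one after the other, reducing to single splittings of [x] and [y],
     whose sum splits [x + y]. *)
  rewrite -riesz_leBlDr; apply: ag => _ [x1 [x2 [xE ->]]].
  rewrite riesz_leBlDl -riesz_leBlDr; apply: bg => _ [y1 [y2 [yE ->]]].
  rewrite riesz_leBlDr; apply: cl.
  exists (x1 + y1), (x2 + y2); split; first exact: disj_sum_disj.
  have x1y1 : disj x1 y1.
    by apply: disj_le xy; [exact: disj_sum_le_abs xE|exact: disj_sum_le_abs yE].
  have x2y2 : disj x2 y2.
    by apply: disj_le xy; apply: disj_sum_le_abs; apply: disj_sum_sym; eassumption.
  by rewrite !oaoD// [RHS]addrACA addrC.
apply: cg => _ [w [z [[xywz wz] ->]]].
have [x1 [x2 [y1 [y2 [xE yE [-> x1y1] [-> x2y2]]]]]] := disj_refinement _ _ _ _ xy wz xywz.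
rewrite !oaoD// addrACA; apply: riesz_leD.
  by apply: al; exists x1, x2.
by apply: bl; exists y1, y2.
Qed.

(** Both parts of a splitting of a fragment of [e] are fragments of [e], so lower bounds add up; the
    trivial splitting gives the upper bound. *)
Lemma infimums_split_sums_laterally_bounded S T L :
  (forall x, infimums (split_sums S T x) (L x)) ->
  laterally_to_order_bounded S -> laterally_to_order_bounded T ->
  laterally_to_order_bounded L.
Proof.
move=> LP Sb Tb e; have [[a aS] [b bS]] := Sb e; have [[a' aT] _] := Tb e.
split.
  exists (a + a') => _ [x xe <-]; apply: (LP x).2 => _ [u [v [xE ->]]].
  apply: riesz_leD.
    by apply: aS; exists u => //; exact: disj_sum_fragment xE.
  by apply: aT; exists v => //; exact: disj_sum_fragment (disj_sum_sym _ _ _ xE).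
exists b => _ [x xe <-]; apply: (@le_trans _ _ (S x)); last by apply: bS; exists x.
exact: (LP x).1 (split_sums_l S T x).
Qed.

Lemma infimums_split_sums_uryson S T L :
  (forall x, infimums (split_sums S T x) (L x)) ->
  uryson S -> uryson T -> uryson L.
Proof.
move=> LP Sb Tb A [[a aA] [b bA]].
pose c := riesz_abs a + riesz_abs b.
(* [A] may fail to contain the parts of splittings of its elements; the larger set [B] does contain
   them and is still order bounded. *)
pose B := [set x : E | riesz_abs x <= c].
have AB x : A x -> B x by move=> Ax; apply: riesz_abs_itv; [exact: aA|exact: bA].
have Bb : order_bounded B.
  split; [exists (- c)|exists c] => x; rewrite /B/= riesz_abs_le => /andP[xc Nxc].
    by rewrite -riesz_leN2 opprK.
  exact: xc.
have [[s sS] [t tS]] := Sb _ Bb; have [[s' sT] _] := Tb _ Bb.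
split.
  exists (s + s') => _ [x /AB xB <-]; apply: (LP x).2 => _ [u [v [xE ->]]].
  apply: riesz_leD.
    by apply: sS; exists u => //; exact: le_trans (disj_sum_le_abs _ _ _ xE) xB.
  apply: sT; exists v => //.
  exact: le_trans (disj_sum_le_abs _ _ _ (disj_sum_sym _ _ _ xE)) xB.
exists t => _ [x /AB xB <-]; apply: (@le_trans _ _ (S x)); last by apply: tS; exists x.
exact: (LP x).1 (split_sums_l S T x).
Qed.
End InfimumOfSplittings.

Theorem corollary3p3 (R : realType) (E F : rieszType R) (S T : oao E F) :
  (forall x : E, infimums (split_sums S T x) !=set0) ->
  exists M : oao E F,
    [/\ infimums [set S; T] M,
        forall x : E, M x = infimum 0 (split_sums S T x),
        laterally_to_order_bounded S -> laterally_to_order_bounded T ->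
          laterally_to_order_bounded M
      & uryson S -> uryson T -> uryson M].
Proof.
move=> inf_ex; pose M x := infimum 0 (split_sums S T x).
have MP x : infimums (split_sums S T x) (M x).
  by apply: infimumP => //; exists (S x); exact: split_sums_l.
have M_oao : M \in @oao_pred R E F.
  by apply/asboolP => x y xy; exact: infimums_split_sumsD xy (MP x) (MP y) (MP _).
exists (Oao M_oao); split=> //.
- split=> [_ [->|->]|L LST].
  + by apply/oao_leP => x; exact: (MP x).1 (split_sums_l S T x).
  + by apply/oao_leP => x; exact: (MP x).1 (split_sums_r S T x).
  (* An orthogonally additive lower bound [L] distributes over each splitting, so [L x] is below
     every sum. *)
  + apply/oao_leP => x; apply: (MP x).2; apply: split_sums_lbound.
      by apply: LST; left.
    by apply: LST; right.
- exact: infimums_split_sums_laterally_bounded.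
- exact: infimums_split_sums_uryson.
Qed.
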